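(* Let $A\subseteq\mathbb{R}$ be an open invex set with respect to $\eta:A\times A\to\mathbb{R}$ and let $a,b\in A$ with $a<a+\eta(b,a)$. Let $f:A\to\mathbb{R}$ be differentiable with $f'\in L[a,a+\eta(b,a)]$, and suppose $|f'|^q$ is preinvex on $A$ for some fixed $q>1$. Let $p$ satisfy $\frac1p+\frac1q=1$ and let $\alpha\in[0,1]$. Then \[ \left|\frac{f(a)+f(a+\eta(b,a))}{2}-\frac{\Gamma(\alpha+1)}{2\eta^{\alpha}(b,a)}\Big[J_{a^+}^{\alpha}f\big(a+\eta(b,a)\big)+J_{(a+\eta(b,a))^-}^{\alpha}f(a)\Big]\right|\le\frac{\eta(b,a)}{2(\alpha p+1)^{1/p}}\left(\frac{|f'(a)|^q+|f'(b)|^q}{2}\right)^{1/q}. \]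
   Context: A set $A\subseteq\mathbb{R}$ is invex with respect to $\eta:A\times A\to\mathbb{R}$ if $x+t\eta(y,x)\in A$ for all $x,y\in A$ and $t\in[0,1]$. A function $g$ on an invex set $A$ is preinvex with respect to $\eta$ if $g(x+t\eta(y,x))\le(1-t)g(x)+tg(y)$ for all $x,y\in A$, $t\in[0,1]$. For $g\in L[c,d]$ and $\alpha>0$, the Riemann–Liouville fractional integrals are $J_{c^+}^{\alpha}g(x)=\frac{1}{\Gamma(\alpha)}\int_c^x(x-t)^{\alpha-1}g(t)\,dt$ for $x>c$ and $J_{d^-}^{\alpha}g(x)=\frac{1}{\Gamma(\alpha)}\int_x^d(t-x)^{\alpha-1}g(t)\,dt$ for $x<d$, with the convention $J_{c^+}^{0}g=J_{d^-}^{0}g=g$; $\eta^{\alpha}(b,a)=(\eta(b,a))^{\alpha}$. *)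

(* Defs.v *)
From HB Require Import structures.
From mathcomp Require Import all_boot all_order all_algebra.
From mathcomp Require Import all_classical all_reals all_analysis.
Set Implicit Arguments. Unset Strict Implicit. Unset Printing Implicit Defensive.
Import Order.TTheory GRing.Theory Num.Theory.
Import numFieldNormedType.Exports.
Local Open Scope classical_set_scope.
Local Open Scope ring_scope.

Section Defs.
Variable R : realType.

Definition Gamma (x : R) : R :=
  \int[(@lebesgue_measure R)]_(t in `]0, +oo[) (t `^ (x - 1) * expR (- t)).

Definition invex (A : set R) (eta : R -> R -> R) : Prop :=
  forall x y, A x -> A y -> forall t : R, 0 <= t <= 1 -> A (x + t * eta y x).

Definition preinvex (A : set R) (eta : R -> R -> R) (g : R -> R) : Prop :=
  forall x y, A x -> A y -> forall t : R, 0 <= t <= 1 ->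
    g (x + t * eta y x) <= (1 - t) * g x + t * g y.

Definition RL_left (alpha c : R) (g : R -> R) (x : R) : R :=
  if alpha == 0 then g x else
  (Gamma alpha)^-1 *
    \int[(@lebesgue_measure R)]_(t in `[c, x]) ((x - t) `^ (alpha - 1) * g t).

Definition RL_right (alpha d : R) (g : R -> R) (x : R) : R :=
  if alpha == 0 then g x else
  (Gamma alpha)^-1 *
    \int[(@lebesgue_measure R)]_(t in `[x, d]) ((t - x) `^ (alpha - 1) * g t).

End Defs.

(* Main.v *)
(** For alpha > 0 put d = a + eta(b,a) and G x = (x-a)^alpha - (d-x)^alpha.
    The function Psi x = G x * f x - \int_a^x G' f is continuous on [a, d], has
    derivative G * f' on ]a, d[, and Psi d - Psi a is the quantity to be bounded,
    up to the factor 2 eta^alpha, because Gamma (alpha+1) = alpha Gamma alpha.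
    Subadditivity of t |-> t^alpha gives |G x| <= |2x-a-d|^alpha, and preinvexity
    bounds |f'|^q by a linear function; a weighted Young inequality then bounds
    |G f'| by the derivative of an explicit Theta whose increment over [a, d] is
    at most the Hoelder bound.  The mean value theorem concludes, with no need
    of the fundamental theorem of calculus for f', which need not be continuous. *)
Require Import Defs.
From HB Require Import structures.
From mathcomp Require Import all_boot all_order all_algebra.
From mathcomp Require Import all_classical all_reals all_analysis.
From mathcomp Require Import measurable_realfun ring lra.
Import Order.TTheory GRing.Theory Num.Theory.
Import numFieldNormedType.Exports.
Local Open Scope classical_set_scope.
Local Open Scope ring_scope.

(** * Continuity and derivatives of powers of the absolute value *)

Lemma continuous_norm_powR (R : realType) (s : R) : 0 < s ->
  continuous (fun x : R => `|x| `^ s).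
Proof.
move=> s0 x; have [->|x0] := eqVneq x 0.
  apply/cvgrPdist_lt => e e0; rewrite normr0 powR0 ?gt_eqF//.
  have d0 : 0 < e `^ s^-1 by rewrite powR_gt0.
  near=> y; rewrite sub0r normrN ger0_norm ?powR_ge0//.
  have ye : `|y| < e `^ s^-1 by near: y; exists (e `^ s^-1) => //= z; rewrite /ball_/= sub0r normrN.
  rewrite -[ltRHS](powRr1 (ltW e0)) -(mulVf (lt0r_neq0 s0)) powRrM.
  by apply: gt0_ltr_powR; rewrite ?nnegrE ?powR_ge0.
have nx0 : 0 < `|x| by rewrite normr_gt0.
apply: (@continuous_comp _ _ _ (@Num.norm R R) (fun y => y `^ s)).
  exact: norm_continuous.
apply: differentiable_continuous; apply/derivable1_diffP.
exact: (@ex_derive _ _ _ _ _ _ _ (is_derive1_powR s nx0)).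
Unshelve. all: by end_near. Qed.

Lemma is_derive_norm_powR (R : realType) (s x : R) : x != 0 ->
  is_derive x 1 (fun y : R => `|y| `^ s) (s * `|x| `^ (s - 1) * Num.sg x).
Proof.
move=> x0; have nx0 : 0 < `|x| by rewrite normr_gt0.
apply: (@is_derive1_comp R (fun y => y `^ s) (@Num.norm R R)).
  exact: is_derive1_powR.
have [xlt0|xgt0] := orP (lt_total x0).
  apply: (@near_eq_is_derive _ _ _ (fun y : R => - y)).
    by near=> y; rewrite ltr0_norm//; near: y; exact: lt_nbhsl.
  by rewrite ltr0_sg//; exact: is_deriveNid.
apply: (@near_eq_is_derive _ _ _ (fun y : R => y)).
  by near=> y; rewrite gtr0_norm//; near: y; exact: lt_nbhsr.
by rewrite gtr0_sg//; exact: is_derive_id.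
Unshelve. all: by end_near. Qed.

(** At 0 the difference quotient is |h|^r, which tends to 0; elsewhere the product rule applies.
    This yields an antiderivative of |u|^r that stays valid where u vanishes, so no split at the
    midpoint is needed. *)
Lemma is_derive_mul_norm_powR (R : realType) (r x : R) : 0 < r ->
  is_derive x 1 (fun y : R => y * `|y| `^ r) ((r + 1) * `|x| `^ r).
Proof.
move=> r0; have [->|x0] := eqVneq x 0; last first.
  have d := is_derive_norm_powR _ r x x0.
  apply: is_derive_eq (is_deriveM (is_derive_id x 1) d) _.
  rewrite /GRing.scale/= mulr1 mulrDl mul1r; congr (_ + _).
  rewrite mulrCA [x * _]mulrC -!mulrA.
  rewrite -normrEsg [_ `^ (r - 1) * _]mulrC.
  by rewrite mulr_powRB1.
rewrite normr0 powR0 ?gt_eqF// mulr0.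
have c0 : (fun h : R => `|h| `^ r) @ (0 : R)^' --> (0 : R).
  apply: cvg_within_filter; have := continuous_norm_powR _ _ r0 0.
  by rewrite /continuous_at normr0 powR0 ?gt_eqF.
have c : (fun h : R => h^-1 * ((h * 1 + 0) * `|h * 1 + 0| `^ r
    - 0 * `|0 : R| `^ r)) @ (0 : R)^' --> (0 : R).
  apply/(@cvgrPdist_lt R R^o) => e e0; near=> h.
  have h0 : h != 0 by near: h; exact: nbhs_dnbhs_neq.
  rewrite mul0r subr0 addr0 mulr1 mulKf//.
  by near: h; exact: (cvgrPdist_lt _ _).1 c0 e e0.
split; first by apply/cvg_ex; exists 0; exact: c.
exact: cvg_lim c.
Unshelve. all: by end_near. Qed.

(** * Subadditivity of powers with exponent in [0, 1] *)

(** A ratio z / (x + y) in [0, 1] is at most its own s-th power because s <= 1. Scaling by (x + y)^s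
    and summing over z = x and z = y gives the claim. *)
Lemma powRD_le (R : realType) (s x y : R) : 0 <= s <= 1 -> 0 <= x -> 0 <= y ->
  (x + y) `^ s <= x `^ s + y `^ s.
Proof.
move=> /andP[s0 s1] x0 y0.
have [xy0|xy0] := eqVneq (x + y) 0.
  move: (xy0) => /eqP; rewrite paddr_eq0// => /andP[/eqP -> /eqP ->].
  by rewrite addr0 lerDl powR_ge0.
have xy : 0 < x + y by rewrite lt0r xy0 addr_ge0.
have H z : 0 <= z -> z <= x + y -> z / (x + y) * (x + y) `^ s <= z `^ s.
  move=> z0 zxy; have [->|zn0] := eqVneq z 0; first by rewrite !mul0r powR_ge0.
  have zgt0 : 0 < z by rewrite lt0r zn0.
  rewrite -[in leRHS](divfK xy0 z) powRM ?divr_ge0// ?(ltW xy)//.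
  apply: ler_wpM2r; first exact: powR_ge0.
  by apply: ger1_powR => //; rewrite divr_gt0//= ler_pdivrMr// mul1r.
rewrite -[leLHS]mul1r -(divff xy0) mulrDl mulrDl.
by apply: lerD; apply: H => //; rewrite ?lerDl ?lerDr.
Qed.

(** Subadditivity applied to x = (x - y) + y, the larger number being called [x]. It serves with [x]
    and [y] the distances from a point to the two ends of the interval. *)
Lemma dist_powR_le (R : realType) (s x y : R) : 0 <= s <= 1 -> 0 <= x -> 0 <= y ->
  `|x `^ s - y `^ s| <= `|x - y| `^ s.
Proof.
move=> s01; wlog yx : x y / y <= x => [H x0 y0|x0 y0].
  have [yx|/ltW xy] := leP y x; first exact: H.
  by rewrite distrC (distrC x); exact: H.
have s0 : 0 <= s by case/andP: s01.
rewrite (@ger0_norm _ (x - y)) ?subr_ge0// ger0_norm ?subr_ge0; last first.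
  by apply: ge0_ler_powR; rewrite ?nnegrE.
rewrite lerBlDr -[in leLHS](subrK y x).
by apply: powRD_le; rewrite ?subr_ge0.
Qed.

(** * Mean value inequality, and integration up to singular endpoints *)

(** Both g + f and g - f have a nonnegative derivative; the mean value theorem applied to each gives
    one side of the absolute value bound. *)
Lemma mean_value_inequality (R : realType) (f g f' g' : R -> R) (a b : R) :
  a < b ->
  {within `[a, b], continuous f} -> {within `[a, b], continuous g} ->
  (forall x, x \in `]a, b[ -> is_derive x 1 f (f' x)) ->
  (forall x, x \in `]a, b[ -> is_derive x 1 g (g' x)) ->
  (forall x, x \in `]a, b[ -> `|f' x| <= g' x) ->
  `|f b - f a| <= g b - g a.
Proof.
move=> ab cf cg df dg fg; rewrite ler_norml; apply/andP; split.
  have [x xab E] : exists2 c, c \in `]a, b[ &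
      (g \+ f) b - (g \+ f) a = (g' \+ f') c * (b - a).
    apply: MVT => // x; last exact: continuousD (cg x) (cf x).
    by move=> xab; apply: is_deriveD; [exact: dg|exact: df].
  have := fg x xab; rewrite ler_norml => /andP[+ _].
  rewrite -subr_ge0 opprK => h.
  have := mulr_ge0 h (ltW (eqbRL (subr_gt0 _ _) ab)).
  by rewrite [f' x + _]addrC -E /=; lra.
have [x xab E] : exists2 c, c \in `]a, b[ &
    (g \- f) b - (g \- f) a = (g' \- f') c * (b - a).
  apply: MVT => // x; last exact: continuousB (cg x) (cf x).
  by move=> xab; apply: is_deriveB; [exact: dg|exact: df].
have := fg x xab; rewrite ler_norml => /andP[_].
rewrite -subr_ge0 => h.
have := mulr_ge0 h (ltW (eqbRL (subr_gt0 _ _) ab)).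
by rewrite -E /=; lra.
Qed.

(** The integrand may blow up at either end. The open interval is exhausted by compact ones, on
    which the usual theorem applies; monotone convergence handles the integrals and continuity of
    [F] the increments. *)
Lemma ge0_FTC2_oo (R : realType) (f F : R -> R) (a b : R) : a < b ->
  {in `]a, b[, continuous f} -> {in `]a, b[, forall x, 0 <= f x} ->
  {within `[a, b], continuous F} ->
  {in `]a, b[, forall x : R, is_derive x 1 F (f x)} ->
  (\int[@lebesgue_measure R]_(x in `]a, b[) (f x)%:E = (F b - F a)%:E)%E.
Proof.
move=> ab cf f0 cF dF.
(* The factor 1/3 ensures a + e n < b - e n already for n = 0. *)
pose e (n : nat) : R := (b - a) / 3 * n.+1%:R^-1.
have ba : 0 < b - a by rewrite subr_gt0.
have e0 n : 0 < e n by rewrite mulr_gt0 ?divr_gt0// invr_gt0.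
have e3 n : e n <= (b - a) / 3.
  by rewrite ler_piMr ?divr_ge0 ?(ltW ba)// invf_le1// ler1n.
have ecvg : e @ \oo --> (0 : R).
  rewrite -[X in _ --> X](mulr0 ((b - a) / 3)).
  by apply: cvgM; [exact: cvg_cst|exact: cvg_harmonic].
pose D n := `[a + e n, b - e n]%classic.
have uv n : a + e n < b - e n by have := e3 n; lra.
have Dab n : D n `<=` `]a, b[.
  by move=> x; rewrite /D/= !in_itv/= => /andP[]; have := e0 n; lra.
have DE : \bigcup_n D n = `]a, b[%classic.
  apply/seteqP; split; first by move=> x [n _]; exact: Dab.
  move=> x; rewrite /= in_itv/= => /andP[ax xb].
  have m0 : 0 < Num.min (x - a) (b - x) by rewrite lt_min !subr_gt0 ax.
  have [n _ /(_ n (leqnn n))/= h] : \forall n \near \oo, e n < Num.min (x - a) (b - x).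
    exact: (cvgr_lt _ ecvg).
  exists n => //; rewrite /D/= in_itv/=; move: h; rewrite lt_min => /andP[]; lra.
have ndD : nondecreasing_seq D.
  move=> m n mn; apply/subsetPset => x; rewrite /D/= !in_itv/=.
  suff : e n <= e m by lra.
  rewrite ler_wpM2l ?divr_ge0 ?(ltW ba)// lef_pV2 ?posrE//.
  by rewrite ler_nat ltnS.
have mf : measurable_fun `]a, b[ f.
  by apply: open_continuous_measurable_fun => // x; rewrite inE; exact: cf.
have : (\int[@lebesgue_measure R]_(x in D n) (f x)%:E)%E @[n --> \oo] -->
    (\int[@lebesgue_measure R]_(x in `]a, b[) (f x)%:E)%E.
  rewrite -DE; apply: ge0_nondecreasing_set_cvg_integral => //.
  - by move=> n; exact: measurable_itv.
  - move=> n; apply/measurable_EFinP.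
    by apply: measurable_funS mf => //; exact: Dab.
  - by move=> n x /Dab xab; rewrite lee_fin; exact: f0.
move=> /cvg_lim <-//.
apply/cvg_lim => //.
rewrite (_ : (fun _ => _) = (fun n => (F (b - e n) - F (a + e n))%:E)).
  apply: cvg_EFin; first exact: nearW.
  have [_ Fa Fb] := (continuous_within_itvP _ ab).1 cF.
  apply: cvgB.
    move/cvg_at_leftP : Fb; apply; split; first by move=> n; rewrite ltrBlDr ltrDl.
    rewrite -[X in _ --> X]subr0; apply: cvgB => //; exact: cvg_cst.
  move/cvg_at_rightP : Fa; apply; split; first by move=> n; rewrite ltrDl.
  by rewrite -[X in _ --> X]addr0; apply: cvgD => //; exact: cvg_cst.
apply/funext => n; rewrite EFinB; apply: continuous_FTC2 => //.
- apply/continuous_in_subspaceT => x; rewrite inE => /Dab; exact: cf.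
- split.
  + move=> x xn; have xab : x \in `]a, b[ by apply: (Dab n); apply: subset_itv_oo_cc.
    exact: (@ex_derive _ _ _ _ _ _ _ (dF _ xab)).
  + apply: cvg_at_right_filter; apply: differentiable_continuous.
    have xab : a + e n \in `]a, b[ by apply: (Dab n); rewrite /D/= in_itv/= lexx ltW.
    exact/derivable1_diffP/(@ex_derive _ _ _ _ _ _ _ (dF _ xab)).
  + apply: cvg_at_left_filter; apply: differentiable_continuous.
    have xab : b - e n \in `]a, b[ by apply: (Dab n); rewrite /D/= in_itv/= lexx ltW.
    exact/derivable1_diffP/(@ex_derive _ _ _ _ _ _ _ (dF _ xab)).
- move=> x xn; have xab : x \in `]a, b[ by apply: (Dab n); apply: subset_itv_oo_cc.
  by rewrite derive1E (@derive_val _ _ _ _ _ _ _ (dF _ xab)).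
Qed.

(** * The Gamma function: value at 1 and functional equation *)

Lemma integral_expRN (R : realType) (a : R) :
  (\int[@lebesgue_measure R]_(x in `[a, +oo[) (expR (- x))%:E = (expR (- a))%:E)%E.
Proof.
rewrite (@ge0_continuous_FTC2y _ _ (fun x : R => - expR (- x)) a 0).
- by rewrite -EFinB sub0r opprK.
- by move=> x _; exact: expR_ge0.
- apply: continuous_subspaceT => x.
  by apply: continuous_comp; [exact: continuousN|exact: continuous_expR].
- by rewrite -oppr0; apply: cvgN; exact: cvgr_expR.
- by move=> x _; exact: ex_derive.
- apply: cvgN; apply: cvg_at_right_filter.
  by apply: continuous_comp; [exact: continuousN|exact: continuous_expR].
- move=> x _; rewrite derive1E derive_val.
  by rewrite /GRing.scale/= mulrN1 opprK.
Qed.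

Lemma Gamma1 (R : realType) : Gamma (1 : R) = 1.
Proof.
rewrite /Gamma /Rintegral.
under eq_integral do rewrite subrr powRr0 mul1r.
rewrite integral_itv_obnd_cbnd; last first.
  apply/measurable_EFinP; apply: measurableT_comp => //.
by rewrite integral_expRN oppr0 expR0.
Qed.

(** For an integer m >= r, the series term x^(m+1) / (m+1)! is below e^x, so x^r e^(-x) <= (m+1)! /
    x when x >= 1. This removes the boundary term at infinity in the functional equation. *)
Lemma powR_expRN_cvg0 (R : realType) (r : R) :
  n.+1%:R `^ r * expR (- n.+1%:R) @[n --> \oo] --> (0 : R).
Proof.
have [m rm] : exists m : nat, r <= m%:R by exists (Num.truncn r).+1; rewrite ltW// truncnS_gt.
apply: (@squeeze_cvgr _ _ _ _ (fun=> 0) (fun n => m.+1`!%:R * n.+1%:R^-1)); last 2 first.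
- exact: cvg_cst.
- rewrite -[X in _ --> X](mulr0 m.+1`!%:R).
  by apply: cvgM; [exact: cvg_cst|exact: cvg_harmonic].
apply: nearW => n; rewrite mulr_ge0 ?powR_ge0 ?expR_ge0//=.
have x0 : 0 < n.+1%:R :> R by [].
rewrite expRN ler_pdivrMr ?expR_gt0//.
have := @expR_ge1Dxn R n.+1%:R m (ltW x0).
rewrite -lerBrDl => h0.
have h : n.+1%:R ^+ m.+1 / m.+1`!%:R <= expR n.+1%:R :> R by lra.
apply: (@le_trans _ _ (n.+1%:R ^+ m)).
  by rewrite -powR_mulrn ?ler_powR// ler1n.
rewrite mulrAC ler_pdivlMr// mulrC -exprS mulrC.
by rewrite -ler_pdivrMr// ltr0n fact_gt0.
Qed.

(* Both integrals are limits of integrals over [1/(n+1), n+2], where t^r e^-t is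
   an antiderivative of their difference. *)
Lemma GammaD1 (R : realType) (r : R) : 0 < r -> Gamma (r + 1) = r * Gamma r.
Proof.
move=> r0.
pose w (s t : R) := t `^ (s - 1) * expR (- t).
(* The right end is n+2 rather than n+1 so that [D 0] is already nondegenerate. *)
pose D (n : nat) := `[(n.+1%:R^-1 : R), n.+2%:R]%classic.
have D0 n : D n `<=` `]0, +oo[.
  move=> x; rewrite /D/= !in_itv/= andbT => /andP[+ _]; apply: lt_le_trans.
  by rewrite invr_gt0.
have DE : \bigcup_n D n = `]0, +oo[%classic.
  apply/seteqP; split; first by move=> x [n _]; exact: D0.
  move=> x; rewrite /= in_itv/= andbT => x0.
  have [n _ /(_ n (leqnn n))/= [h1 h2]] : \forall n \near \oo,
      n.+1%:R^-1 < x /\ x <= n%:R.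
    near=> n; split; near: n; first exact: (cvgr_lt _ cvg_harmonic).
    exact: nbhs_infty_ger.
  exists n => //; rewrite /D/= in_itv/= ltW//= (le_trans h2)// ler_nat.
  by rewrite -addn2 leq_addr.
have mD n : measurable (D n : set (measurableTypeR R)) by exact: measurable_itv.
have ndD : nondecreasing_seq D.
  move=> m n mn; apply/subsetPset => x; rewrite /D/= !in_itv/= => /andP[h1 h2].
  rewrite (le_trans _ h1) ?(le_trans h2) ?ler_nat ?ltnS// lef_pV2 ?posrE//.
  by rewrite ler_nat ltnS.
have mw s (A : set R) : measurable_fun A (w s).
  apply: measurable_funTS; apply: measurable_funM.
    by apply: (measurableT_comp (measurable_powR _)); exact: measurable_id.
  by apply: measurableT_comp => //; exact: measurable_funN.
have w_cvg s : (\int[lebesgue_measure]_(x in D n) (w s x)%:E)%E @[n --> \oo] -->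
   (\int[lebesgue_measure]_(x in `]0%R, +oo[) (w s x)%:E)%E.
  rewrite -DE; apply: ge0_nondecreasing_set_cvg_integral => //.
  - by move=> n; apply/measurable_EFinP; exact: mw.
  - by move=> n x _; rewrite lee_fin mulr_ge0 ?powR_ge0 ?expR_ge0.
have dpow (s x : R) : 0 < x ->
    is_derive x 1 (fun t => t `^ s * expR (- t))
      (s * x `^ (s - 1) * expR (- x) - x `^ s * expR (- x)).
  move=> x0; have d := is_derive1_powR s x0.
  apply: is_derive_eq (is_deriveM d _) _.
  by rewrite /GRing.scale/=; ring.
have cw s n : {within D n, continuous (w s)}.
  apply: derivable_within_continuous => x /D0; rewrite /= in_itv/= andbT => x0.
  exact: (@ex_derive _ _ _ _ _ _ _ (dpow _ _ x0)).
have iw s n : lebesgue_measure.-integrable (D n) (EFin \o w s).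
  apply: continuous_compact_integrable => //; exact: segment_compact.
pose F (t : R) := t `^ r * expR (- t).
have JE n : (\int[lebesgue_measure]_(x in D n) (w (r + 1)%R x)%:E =
   r%:E * \int[lebesgue_measure]_(x in D n) (w r x)%:E + (F n.+1%:R^-1 - F n.+2%:R)%:E)%E.
  have uv : n.+1%:R^-1 < n.+2%:R :> R.
    by rewrite (@le_lt_trans _ _ 1) ?invf_le1 ?ler1n ?ltr1n.
  pose g t := r * w r t - w (r + 1) t.
  have : (\int[lebesgue_measure]_(x in D n) (g x)%:E = (F n.+2%:R)%:E - (F n.+1%:R^-1)%:E)%E.
    have dF x : x \in D n -> is_derive x 1 F (g x).
      rewrite inE => /D0; rewrite /= in_itv/= andbT => x0.
      apply: is_derive_eq (dpow r x x0) _.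
      by rewrite /g /w addrK mulrA.
    apply: continuous_FTC2 => //.
    - move=> x; apply: (@continuousB _ _ (subspace (D n)) (fun t => r * w r t)).
        by apply: continuousM; [exact: cvg_cst|exact: cw].
      exact: cw.
    - have cF : {within D n, continuous F}.
        apply: derivable_within_continuous => x xD.
        by apply: (@ex_derive _ _ _ _ _ _ _ (dF x _)); rewrite inE.
      have [_ Fa Fb] := (continuous_within_itvP _ uv).1 cF; split => //.
      move=> x xn; apply: (@ex_derive _ _ _ _ _ _ _ (dF x _)).
      by rewrite inE; apply: subset_itv_oo_cc.
    - move=> x xn; rewrite derive1E; apply: (@derive_val _ _ _ _ _ _ _ (dF x _)).
      by rewrite inE; apply: subset_itv_oo_cc.
  have -> : (\int[lebesgue_measure]_(x in D n) (g x)%:E =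
      r%:E * \int[lebesgue_measure]_(x in D n) (w r x)%:E -
      \int[lebesgue_measure]_(x in D n) (w (r + 1)%R x)%:E)%E.
    have iZ : lebesgue_measure.-integrable (D n) (fun x => r%:E * (w r x)%:E)%E.
      by apply: integrableZl; [exact: mD|exact: iw].
    have E := integralB (mD n) iZ (iw (r + 1) n).
    apply: (etrans _ (etrans E _)); first by apply: eq_integral.
    by congr (_ - _)%E; rewrite integralZl//; exact: iw.
  (* Rearranging a difference of extended reals is safe here because both integrals over the compact
     [D n] are finite. *)
  have aux (x y : \bar R) (u v : R) : x \is a fin_num -> y \is a fin_num ->
      (x - y = u%:E - v%:E)%E -> (y = x + (v - u)%:E)%E.
    case: x => [x| |]//; case: y => [y| |]// _ _.
    by rewrite -!EFinB -EFinD => -[h]; congr _%:E; lra.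
  apply: aux; last by exact: (integrable_fin_num _ (iw (r + 1) n)).
  by rewrite fin_numM//; exact: (integrable_fin_num _ (iw r n)).
have F_cvg : F n.+1%:R^-1 - F n.+2%:R @[n --> \oo] --> (0 : R).
  rewrite -[X in _ --> X](subr0 0); apply: cvgB; last first.
    have := powR_expRN_cvg0 R r; rewrite -(cvg_shiftS (fun n => F n.+1%:R)).
    exact.
  (* At the left end t^r tends to 0, as r > 0, while e^(-t) tends to 1. *)
  rewrite -[X in _ --> X](mul0r (expR (- 0))); apply: cvgM.
    have /cvg_at_rightP := powR_cvg0 r0; apply; split => // n.
    exact: cvg_harmonic.
  apply: (@cvg_comp _ _ _ (fun n : nat => - n.+1%:R^-1) expR _ (nbhs (- 0))).
    by apply: cvgN; exact: cvg_harmonic.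
  exact: continuous_expR.
rewrite /Gamma /Rintegral.
have -> : (\int[lebesgue_measure]_(x in `]0%R, +oo[) (w (r + 1)%R x)%:E =
   r%:E * \int[lebesgue_measure]_(x in `]0%R, +oo[) (w r x)%:E)%E.
  have h : (\int[lebesgue_measure]_(x in D n) (w (r + 1)%R x)%:E)%E @[n --> \oo] -->
      (r%:E * \int[lebesgue_measure]_(x in `]0%R, +oo[) (w r x)%:E)%E.
    rewrite (funext JE) -[X in _ --> X]adde0; apply: cvgeD.
    - by rewrite fin_num_adde_defl.
    - exact: cvgeZl.
    - by apply: cvg_EFin; [exact: nearW|exact: F_cvg].
  exact: (cvg_unique _ (w_cvg (r + 1)) h).
have : (0 <= \int[lebesgue_measure]_(x in `]0%R, +oo[) (w r x)%:E)%E.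
  by apply: integral_ge0 => x _; rewrite lee_fin mulr_ge0 ?powR_ge0 ?expR_ge0.
(* No finiteness is required: [fine] sends [+oo] to 0, so both sides would be 0. *)
have aux (x : \bar R) : (0 <= x)%E -> fine (r%:E * x)%E = r * fine x.
  by case: x => [x||]//= _; rewrite gt0_muley ?lte_fin// mulr0.
exact: aux.
Unshelve. all: by end_near. Qed.

(** * Integrable power kernels and positivity of Gamma *)

Lemma is_derive_dist_powR (R : realType) (s c x : R) : x != c ->
  is_derive x 1 (fun y : R => `|y - c| `^ s)
    (s * `|x - c| `^ (s - 1) * Num.sg (x - c)).
Proof.
move=> xc; have xc0 : x - c != 0 by rewrite subr_eq0.
have d : is_derive x 1 (fun y : R => y - c) 1.
  by apply: is_derive_eq; rewrite subr0.
have := @is_derive1_comp R _ (fun y : R => y - c) x _ _ (is_derive_norm_powR _ s _ xc0) d.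
by rewrite mulr1.
Qed.

Lemma continuous_dist_powR (R : realType) (s c : R) : 0 < s ->
  continuous (fun y : R => `|y - c| `^ s).
Proof.
move=> s0 x; apply: (@continuous_comp _ _ _ (fun y : R => y - c) (fun y => `|y| `^ s)).
  by apply: continuousB; [exact: cvg_id|exact: cvg_cst].
exact: continuous_norm_powR.
Qed.

(** On ]a, b[ the sign e of t - c is constant, so (e / s) |t - c|^s is an antiderivative. It is
    continuous up to the ends, hence has a finite increment even when s < 1 and [c] is an
    endpoint. *)
Lemma integrable_dist_powR (R : realType) (s a b c : R) : 0 < s -> a < b ->
  (c <= a) || (b <= c) ->
  (@lebesgue_measure R).-integrable `[a, b] (EFin \o (fun t => `|t - c| `^ (s - 1))).
Proof.
move=> s0 ab cab.
have [e eE] : exists e : R, {in `]a, b[, forall x, (x != c) && (Num.sg (x - c) == e)}.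
  case/orP: cab => [ca|bc]; [exists 1|exists (-1)] => x; rewrite in_itv/= => /andP[ax xb].
    have xc : c < x by exact: le_lt_trans ax.
    by rewrite gt_eqF//= gtr0_sg ?subr_gt0.
  have xc : x < c by exact: lt_le_trans bc.
  by rewrite lt_eqF//= ltr0_sg ?subr_lt0.
(* The sign is read off at the midpoint. It occurs twice in the derivative of the antiderivative,
   once as a coefficient and once from the chain rule. *)
have e2 : e * e = 1.
  have /eE/andP[h /eqP <-] : (a + b) / 2 \in `]a, b[ by rewrite in_itv/=; lra.
  by rewrite -expr2 sqr_sg subr_eq0 h.
have m : measurable_fun [set: R] (fun t : R => `|t - c| `^ (s - 1)).
  apply: (measurableT_comp (measurable_powR _)); apply: measurableT_comp => //.
  exact: measurable_funB.
have cF : continuous (fun t : R => e / s * `|t - c| `^ s).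
  move=> x; apply: cvgM; first exact: cvg_cst.
  exact: continuous_dist_powR.
apply/integrableP; split; first by apply/measurable_EFinP; exact: measurable_funTS.
under eq_integral do rewrite /= ger0_norm ?powR_ge0//.
rewrite integral_itv_bndoo; last by apply/measurable_EFinP; exact: measurable_funTS.
rewrite (@ge0_FTC2_oo _ _ (fun t => e / s * `|t - c| `^ s))//; first exact: ltry.
- move=> x /eE/andP[xc _]; apply: differentiable_continuous; apply/derivable1_diffP.
  exact: (@ex_derive _ _ _ _ _ _ _ (is_derive_dist_powR _ (s - 1) _ _ xc)).
- exact: continuous_subspaceT cF.
- move=> x /eE/andP[xc /eqP sgE]; have d := is_derive_dist_powR _ s _ _ xc.
  apply: is_derive_eq (is_deriveM (is_derive_cst (e / s) x 1) d) _.
  rewrite /GRing.scale/= mulr0 addr0 sgE.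
  rewrite [LHS](_ : _ = (e * e) * (s / s) * `|x - c| `^ (s - 1)); last by ring.
  by rewrite e2 divff ?gt_eqF// !mul1r.
Qed.

(** Finiteness must be shown too, since [fine] would turn an infinite integral into 0. On ]0, 1] the
    integrand lies between e^(-1) and t^(r-1), because r <= 1; beyond 1 it is at most e^(-t). *)
Lemma Gamma_gt0 (R : realType) (r : R) : 0 < r <= 1 -> 0 < Gamma r.
Proof.
move=> /andP[r0 r1].
pose w (t : R) := t `^ (r - 1) * expR (- t).
have w0 t : 0 <= w t by rewrite mulr_ge0 ?powR_ge0 ?expR_ge0.
have mw (A : set R) : measurable_fun A w.
  apply: measurable_funTS; apply: measurable_funM.
    by apply: (measurableT_comp (measurable_powR _)); exact: measurable_id.
  by apply: measurableT_comp => //; exact: measurable_funN.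
have me (A : set R) : measurable_fun A (fun t : R => expR (- t)).
  by apply: measurable_funTS; apply: measurableT_comp => //; exact: measurable_funN.
have E : (\int[@lebesgue_measure R]_(x in `]0%R, +oo[) (w x)%:E =
  \int[@lebesgue_measure R]_(x in `]0%R, 1%R]) (w x)%:E +
  \int[@lebesgue_measure R]_(x in `]1%R, +oo[) (w x)%:E)%E.
  rewrite -ge0_integral_setU//=.
  - by rewrite -itv_bndbnd_setU ?bnd_simp.
  - by apply/measurable_EFinP; exact: mw.
  - by move=> x _; rewrite lee_fin.
  - apply/disj_set2P; rewrite -subset0 => z/=; rewrite !in_itv/= => -[/andP[_]].
    by rewrite leNgt => /negbTE ->.
have lb : ((expR (- 1))%:E <= \int[@lebesgue_measure R]_(x in `]0%R, 1%R]) (w x)%:E)%E.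
  have -> : (expR (- 1))%:E =
      (\int[@lebesgue_measure R]_(x in `]0%R, 1%R]) (cst (expR (- 1))%:E x))%E.
    by rewrite integral_cst//= lebesgue_measure_itv/= lte_fin ltr01 oppr0 adde0 mule1.
  apply: ge0_le_integral => //.
  - by move=> x _; rewrite lee_fin expR_ge0.
  - by apply/measurable_EFinP; exact: mw.
  - move=> x; rewrite /= in_itv/= => /andP[x0 x1]; rewrite lee_fin /w.
    rewrite -[leLHS]mul1r ler_pM ?expR_ge0//; last by rewrite ler_expR lerN2.
    by rewrite -[leLHS](powRr0 x) ger_powR ?x0// subr_le0.
have ub1 : (\int[@lebesgue_measure R]_(x in `]0%R, 1%R]) (w x)%:E < +oo)%E.
  have i1 : (@lebesgue_measure R).-integrable `]0, 1] (EFin \o (fun t => `|t - 0| `^ (r - 1))).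
    have i := integrable_dist_powR _ _ _ _ 0 r0 (@ltr01 R).
    apply: integrableS (i _) => //; last by rewrite lexx.
    by move=> x /=; rewrite !in_itv/= => /andP[/ltW -> ->].
  have l1 : (\int[@lebesgue_measure R]_(x in `]0%R, 1%R]) (`|x - 0| `^ (r - 1))%:E < +oo)%E.
    exact: integrable_lty i1.
  apply: le_lt_trans l1; apply: ge0_le_integral => //.
  - by move=> x _; rewrite lee_fin.
  - by apply/measurable_EFinP; exact: mw.
  - exact: measurable_int i1.
  - move=> x; rewrite /= in_itv/= => /andP[x0 _]; rewrite lee_fin subr0 gtr0_norm//.
    by rewrite ler_piMr ?powR_ge0// expR_le1 oppr_le0 ltW.
have ub2 : (\int[@lebesgue_measure R]_(x in `]1%R, +oo[) (w x)%:E < +oo)%E.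
  apply: (@le_lt_trans _ _ (expR (- 1))%:E); last exact: ltry.
  rewrite -integral_expRN -integral_itv_obnd_cbnd; last by apply/measurable_EFinP; exact: me.
  apply: ge0_le_integral => //.
  - by move=> x _; rewrite lee_fin.
  - by apply/measurable_EFinP; exact: mw.
  - by apply/measurable_EFinP; exact: me.
  - move=> x; rewrite /= in_itv/= andbT => x1; rewrite lee_fin /w ler_piMl ?expR_ge0//.
    by rewrite -[leRHS](powRr0 x) ler_powR ?subr_le0// ltW.
rewrite /Gamma /Rintegral fine_gt0// E; apply/andP; split; last exact: lte_add_pinfty.
apply: (@lt_le_trans _ _ (expR (- 1))%:E); first by rewrite lte_fin expR_gt0.
by apply: (le_trans lb); rewrite leeDl// integral_ge0// => x _; rewrite lee_fin.
Qed.

(** * A pointwise form of the Hoelder inequality *)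

(** Young's inequality for x / P^(1/p) and y / Q^(1/q). With [P] and [Q] the integrals of x^p and
    y^q, the bracket on the right integrates to 1/p + 1/q = 1. *)
Lemma mul_le_scaled_young (R : realType) (x y P Q p q : R) :
  0 <= x -> 0 <= y -> 0 < P -> 0 < Q -> 0 < p -> 0 < q -> p^-1 + q^-1 = 1 ->
  x * y <= P `^ p^-1 * Q `^ q^-1 * (x `^ p / (P * p) + y `^ q / (Q * q)).
Proof.
move=> x0 y0 P0 Q0 p0 q0 pq.
have E (z S s : R) : 0 <= z -> 0 < S -> 0 < s ->
    (z / S `^ s^-1) `^ s / s = z `^ s / (S * s).
  move=> z0 S0 s0; rewrite powRM ?invr_ge0 ?powR_ge0//.
  rewrite -powRN -powRrM mulNr mulVf ?gt_eqF// powRN powRr1 ?ltW//.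
  by rewrite invfM mulrA.
rewrite -!E//.
have P1 : 0 < P `^ p^-1 by rewrite powR_gt0.
have Q1 : 0 < Q `^ q^-1 by rewrite powR_gt0.
rewrite -ler_pdivrMl ?mulr_gt0//.
rewrite [leLHS](_ : _ = x / P `^ p^-1 * (y / Q `^ q^-1)).
  by apply: conjugate_powR => //; rewrite divr_ge0 ?powR_ge0.
by rewrite invfM; ring.
Qed.

(** * The trapezoid estimate for positive order *)

(** [A] and [B] stand for |f'(a)|^q and |f'(b)|^q, where b may differ from [d]. The two factors on
    the right come from the integrals over [a, d] of |2x - a - d|^(sp) and of the linear bound. *)
Lemma fractional_trapezoid_bound (R : realType) (f f' : R -> R)
    (a d A B p q s : R) :
  a < d -> 0 < s <= 1 -> 0 < p -> 0 < q -> p^-1 + q^-1 = 1 ->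
  0 <= A -> 0 <= B ->
  (forall x, x \in `[a, d] -> is_derive x 1 f (f' x)) ->
  (forall x, x \in `]a, d[ ->
    `|f' x| `^ q <= A + (B - A) * ((x - a) / (d - a))) ->
  `|(d - a) `^ s * (f a + f d)
    - s * (\int[@lebesgue_measure R]_(t in `[a, d]) ((d - t) `^ (s - 1) * f t)
         + \int[@lebesgue_measure R]_(t in `[a, d]) ((t - a) `^ (s - 1) * f t))|
  <= ((d - a) `^ (s * p + 1) / (s * p + 1)) `^ p^-1 *
     ((d - a) * ((A + B) / 2)) `^ q^-1.
Proof.
move=> ad /andP[s0 s1] p0 q0 pq A0 B0 df f'le.
have h0 : 0 < d - a by rewrite subr_gt0.
have sub x : x \in `]a, d[ -> x \in `[a, d] by apply: subset_itv_oo_cc.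
have cf : {within `[a, d], continuous f}.
  apply: derivable_within_continuous => x xad.
  exact: (@ex_derive _ _ _ _ _ _ _ (df x xad)).
have mf : measurable_fun `[a, d] f by exact: subspace_continuous_measurable_fun.
have bf : [bounded f x | x in `[a, d]].
  have := compact_bounded (continuous_compact cf (@segment_compact _ a d)).
  by move=> [M [Mr HM]]; exists M; split => // y /HM {}HM x /= xad; apply: HM; exists x.
have i1 : (@lebesgue_measure R).-integrable `[a, d]
    (EFin \o (fun t => `|t - d| `^ (s - 1) * f t)).
  have i : (@lebesgue_measure R).-integrable `[a, d] (EFin \o (fun t => `|t - d| `^ (s - 1))).
    by apply: integrable_dist_powR => //; rewrite lexx orbT.
  apply: eq_integrable (integrableMl _ i mf bf) => //.
have i2 : (@lebesgue_measure R).-integrable `[a, d]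
    (EFin \o (fun t => `|t - a| `^ (s - 1) * f t)).
  have i : (@lebesgue_measure R).-integrable `[a, d] (EFin \o (fun t => `|t - a| `^ (s - 1))).
    by apply: integrable_dist_powR => //; rewrite lexx.
  apply: eq_integrable (integrableMl _ i mf bf) => //.
(* Absolute values put both kernels in the form |t - c|^(s-1) covered by the lemmas above. *)
have -> : \int[@lebesgue_measure R]_(t in `[a, d]) ((d - t) `^ (s - 1) * f t) =
    \int[@lebesgue_measure R]_(t in `[a, d]) (`|t - d| `^ (s - 1) * f t).
  apply: eq_Rintegral => t; rewrite inE/= in_itv/= => /andP[_ td].
  by rewrite distrC ger0_norm ?subr_ge0.
have -> : \int[@lebesgue_measure R]_(t in `[a, d]) ((t - a) `^ (s - 1) * f t) =
    \int[@lebesgue_measure R]_(t in `[a, d]) (`|t - a| `^ (s - 1) * f t).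
  apply: eq_Rintegral => t; rewrite inE/= in_itv/= => /andP[ta _].
  by rewrite ger0_norm ?subr_ge0.
rewrite -RintegralD//.
have i12 : (@lebesgue_measure R).-integrable `[a, d]
    (EFin \o (fun t => `|t - d| `^ (s - 1) * f t + `|t - a| `^ (s - 1) * f t)).
  by apply: eq_integrable (integrableD _ i1 i2).
rewrite -RintegralZl//.
(* This is G' f for the [G] defined below. *)
set g := fun t => s * (`|t - d| `^ (s - 1) * f t + `|t - a| `^ (s - 1) * f t).
have ig : (@lebesgue_measure R).-integrable `[a, d] (EFin \o g).
  by apply: eq_integrable (integrableZl _ s i12).
pose G (x : R) := `|x - a| `^ s - `|x - d| `^ s.
pose Psi (x : R) := G x * f x - \int[@lebesgue_measure R]_(t in `[a, x]) g t.
(* G takes the values -(d - a)^s at [a] and (d - a)^s at [d], whence the sum f a + f d. *)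
have PsiE : Psi d - Psi a =
    (d - a) `^ s * (f a + f d) - \int[@lebesgue_measure R]_(t in `[a, d]) g t.
  rewrite /Psi set_itv1 Rintegral_set1 /G !subrr normr0 powR0 ?gt_eqF//.
  by rewrite [`|a - d|]distrC (gtr0_norm h0); ring.
rewrite -PsiE.
have cG : continuous G.
  by move=> x; apply: (@continuousB _ _ _ (fun x : R => `|x - a| `^ s));
    exact: continuous_dist_powR.
have cPsi : {within `[a, d], continuous Psi}.
  move=> x; apply: (@continuousB _ _ (subspace `[a, d]) (fun x => G x * f x)).
    apply: continuousM; last exact: cf.
    by apply: continuous_subspaceT.
  exact: (parameterized_integral_continuous (ltW ad) ig).
have dPsi x : x \in `]a, d[ -> is_derive x 1 Psi (G x * f' x).
  move=> xad; have /[!in_itv]/= /andP[ax xd] := xad.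
  have xa : x != a by rewrite gt_eqF.
  have xd' : x != d by rewrite lt_eqF.
  have dG : is_derive x 1 G (s * `|x - a| `^ (s - 1) * Num.sg (x - a)
      - s * `|x - d| `^ (s - 1) * Num.sg (x - d)).
    exact: is_deriveB (is_derive_dist_powR _ s _ _ xa) (is_derive_dist_powR _ s _ _ xd').
  (* The kernels are singular only at the ends, so the integral in [Psi] can be differentiated at an
     interior x; its derivative g cancels the term G' f of the product rule. *)
  have cg : {for x, continuous g}.
    have dfx := df x (sub x xad).
    have c1 := is_derive_dist_powR _ (s - 1) _ _ xa.
    have c2 := is_derive_dist_powR _ (s - 1) _ _ xd'.
    apply: differentiable_continuous; apply/derivable1_diffP.
    have dg := is_deriveM (is_derive_cst s x 1)
      (is_deriveD (is_deriveM c2 dfx) (is_deriveM c1 dfx)).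
    exact: (@ex_derive _ _ _ _ _ _ _ dg).
  have [dI I'] := continuous_FTC1_closed xd ig ax cg.
  have dI' := DeriveDef dI (etrans (esym (derive1E _ _)) I').
  apply: is_derive_eq (is_deriveB (is_deriveM dG (df x (sub x xad))) dI') _.
  rewrite /GRing.scale/= gtr0_sg ?subr_gt0// ltr0_sg ?subr_lt0// /g /G mulr1 mulrN1.
  ring.
pose r := s * p.
have r0 : 0 < r by rewrite mulr_gt0.
pose u (x : R) := 2 * x - (a + d).
(* K and L are antiderivatives of [|u|^r] and of the linear bound l on [|f'|^q]. *)
pose K (x : R) := u x * `|u x| `^ r / (2 * (r + 1)).
pose L (x : R) := A * x + (B - A) / (2 * (d - a)) * ((x - a) * (x - a)).
pose l (x : R) := A + (B - A) * ((x - a) / (d - a)).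
have dK (x : R) : is_derive x 1 K (`|u x| `^ r).
  have du : is_derive x 1 u 2.
    rewrite /u; apply: is_derive_eq (is_deriveB (is_deriveM (is_derive_cst (2 : R) x 1) (is_derive_id x 1))
      (is_derive_cst (a + d) x 1)) _.
    by rewrite /GRing.scale/= mulr0 mulr1 addr0 subr0.
  have dm := @is_derive1_comp R _ u x _ _ (is_derive_mul_norm_powR _ r (u x) r0) du.
  have r1 : r + 1 != 0 by rewrite gt_eqF// addr_gt0.
  rewrite /K; apply: is_derive_eq (is_deriveM dm (is_derive_cst (2 * (r + 1))^-1 x 1)) _.
  by rewrite /GRing.scale/= mulr0 add0r; field.
have dL (x : R) : is_derive x 1 L (l x).
  have dxa : is_derive x 1 (fun y : R => y - a) 1.
    by apply: is_derive_eq (is_deriveB (is_derive_id x 1) (is_derive_cst a x 1)) _; rewrite subr0.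
  rewrite /L; apply: is_derive_eq (is_deriveD (is_deriveM (is_derive_cst A x 1) (is_derive_id x 1))
    (is_deriveM (is_derive_cst ((B - A) / (2 * (d - a))) x 1) (is_deriveM dxa dxa))) _.
  have h1 : d - a != 0 by rewrite gt_eqF.
  by rewrite /GRing.scale/= /l; field.
set P := (d - a) `^ (r + 1) / (r + 1).
set Q := (d - a) * ((A + B) / 2).
have P0 : 0 < P by rewrite divr_gt0 ?powR_gt0// addr_gt0.
have Q0 : 0 <= Q by rewrite mulr_ge0 ?(ltW h0)// divr_ge0// addr_ge0.
set C := _ * _ `^ _.
have C0 : 0 <= C by rewrite mulr_ge0 ?powR_ge0.
pose Theta (x : R) := C * (K x / (P * p) + L x / (Q * q)).
have dTheta (x : R) :
    is_derive x 1 Theta (C * (`|u x| `^ r / (P * p) + l x / (Q * q))).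
  rewrite /Theta; apply: is_derive_eq (is_deriveM (is_derive_cst C x 1)
    (is_deriveD (is_deriveM (dK x) (is_derive_cst (P * p)^-1 x 1))
      (is_deriveM (dL x) (is_derive_cst (Q * q)^-1 x 1)))) _.
  by rewrite /GRing.scale/=; ring.
have cTheta : {within `[a, d], continuous Theta}.
  apply: derivable_within_continuous => x _.
  exact: (@ex_derive _ _ _ _ _ _ _ (dTheta x)).
apply: (@le_trans _ _ (Theta d - Theta a)).
  apply: (@mean_value_inequality R Psi Theta (fun x => G x * f' x)
    (fun x => C * (`|u x| `^ r / (P * p) + l x / (Q * q))) a d
    ad cPsi cTheta dPsi (fun x _ => dTheta x)) => x xad.
  have /[!in_itv]/= /andP[ax xd] := xad.
  have := f'le x xad; rewrite -/(l x) => lx.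
  (* The scaled Young inequality requires Q > 0. When Q = 0, both [A] and [B] vanish, which forces
     f' x = 0. *)
  have [Q00|Qn0] := eqVneq Q 0.
    have AB0 : A + B = 0.
      by move/eqP: Q00; rewrite !mulf_eq0 gt_eqF//= invr_eq0 pnatr_eq0/= orbF => /eqP.
    have A00 : A = 0 by lra.
    have B00 : B = 0 by lra.
    move: lx; rewrite /l A00 B00 subrr mul0r addr0 => lx.
    have /powR_eq0_eq0/eqP : `|f' x| `^ q = 0 by apply/eqP; rewrite eq_le lx powR_ge0.
    rewrite normr_eq0 => /eqP ->; rewrite mulr0 normr0; apply: (mulr_ge0 C0).
    rewrite mul0r addr0.
    by rewrite divr_ge0 ?powR_ge0// mulr_ge0 ?(ltW P0) ?(ltW p0).
  have Qgt0 : 0 < Q by rewrite lt0r Qn0.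
  rewrite normrM.
  apply: (le_trans (mul_le_scaled_young _ _ _ _ _ _ _ (normr_ge0 _) (normr_ge0 _) P0 Qgt0 p0 q0 pq)).
  apply: (ler_wpM2l C0); apply: lerD; last first.
    by apply: ler_wpM2r lx; rewrite invr_ge0 mulr_ge0// ltW.
  apply: ler_wpM2r; first by rewrite invr_ge0 mulr_ge0 ?(ltW P0) ?(ltW p0).
  (* Since |u|^r = (|u|^s)^p, it suffices that |G x| <= |u x|^s, and u x is the difference of the
     distances x - a and d - x. *)
  rewrite /r powRrM ge0_ler_powR ?nnegrE ?powR_ge0 ?(ltW p0)//.
  apply: le_trans (dist_powR_le _ s _ _ _ _ _) _; rewrite ?(ltW s0)//.
  rewrite (@gtr0_norm _ (x - a)) ?subr_gt0// (@ltr0_norm _ (x - d)) ?subr_lt0//.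
  by rewrite (_ : x - a - - (x - d) = u x) // /u; ring.
(* [P] and [Q] are exactly the increments of [K] and [L], so [C] gets multiplied by at most 1/p +
   1/q = 1. *)
have -> : Theta d - Theta a = C * (p^-1 + Q / (Q * q)).
  have ua : u a = - (d - a) by rewrite /u; ring.
  have ud : u d = d - a by rewrite /u; ring.
  have r1 : r + 1 != 0 by rewrite gt_eqF// addr_gt0.
  have KE : K d - K a = P.
    rewrite /K ua ud normrN (gtr0_norm h0) /P powRD; last by rewrite (gt_eqF h0) implybT.
    by rewrite powRr1 ?(ltW h0)//; field.
  have LE : L d - L a = Q.
    have h1 : d - a != 0 by rewrite gt_eqF.
    by rewrite /L /Q; field.
  rewrite /Theta -mulrBr; congr (C * _).
  have aux (x1 x0 y1 y0 c1 c2 : R) :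
    x1 / c1 + y1 / c2 - (x0 / c1 + y0 / c2) = (x1 - x0) / c1 + (y1 - y0) / c2 by ring.
  rewrite aux KE LE; congr (_ + _).
  by rewrite invfM mulrA divff ?mul1r// gt_eqF.
rewrite ler_piMr// -pq lerD2l.
have [->|Qn0] := eqVneq Q 0; first by rewrite mul0r invr_ge0 ltW.
by rewrite invfM mulrA divff// mul1r.
Qed.

(** * Reduction of the theorem to the trapezoid estimate *)

Theorem theorem2p4 (R : realType) (A : set R) (eta : R -> R -> R)
  (f : R -> R) (a b q p alpha : R) :
  open A -> invex A eta ->
  A a -> A b -> a < a + eta b a ->
  (forall x, A x -> derivable f x 1) ->
  (@lebesgue_measure R).-integrable `[a, a + eta b a] (EFin \o (derive1 f)) ->
  1 < q ->
  preinvex A eta (fun x => `|(derive1 f) x| `^ q) ->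
  p^-1 + q^-1 = 1 ->
  0 <= alpha <= 1 ->
  `| (f a + f (a + eta b a)) / 2
     - Gamma (alpha + 1) / (2 * (eta b a) `^ alpha) *
       (RL_left alpha a f (a + eta b a) + RL_right alpha (a + eta b a) f a) |
  <= eta b a / (2 * (alpha * p + 1) `^ p^-1) *
     ((`|(derive1 f) a| `^ q + `|(derive1 f) b| `^ q) / 2) `^ q^-1.
Proof.
move=> _ Ainv Aa Ab + df _ q1 f'inv pq /andP[al0 al1].
set h := eta b a; rewrite ltrDl => h0.
have q0 : 0 < q by exact: lt_trans q1.
have p0 : 0 < p.
  by rewrite -invr_gt0 -(addrK q^-1 p^-1) pq subr_gt0 invf_lt1.
have r1 : 0 < alpha * p + 1 by rewrite ltr_wpDl ?mulr_ge0 ?(ltW p0).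
(* At order 0 the integrals are the values f (a + h) and f a, so the left side is 0. *)
have [alpha0|alphaN0] := eqVneq alpha 0.
  rewrite /RL_left /RL_right alpha0 eqxx add0r Gamma1 powRr0 mulr1 mul1r.
  rewrite [X in `|X|](_ : _ = 0) ?normr0; last by lra.
  by rewrite mulr_ge0 ?powR_ge0// divr_ge0 ?(ltW h0)// mulr_ge0 ?powR_ge0.
have alpha_gt0 : 0 < alpha by rewrite lt0r alphaN0.
rewrite /RL_left /RL_right (negbTE alphaN0) GammaD1// -mulrDr.
set J := (X in _^-1 * X).
have G0 : Gamma alpha != 0 by rewrite gt_eqF// Gamma_gt0 ?alpha_gt0.
have t01 x : x \in `[a, a + h] -> 0 <= (x - a) / h <= 1.
  rewrite in_itv/= => /andP[ax xd].
  by rewrite divr_ge0 ?subr_ge0 ?(ltW h0)//= ler_pdivrMr// mul1r lerBlDl.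
(* With t = (x - a) / h, invexity places the whole segment in [A], and preinvexity becomes a bound
   linear in x. *)
have xE x : x = a + (x - a) / h * h by rewrite divfK ?gt_eqF// subrKC.
have ha : 0 < h `^ alpha by rewrite powR_gt0.
have aux (t X Y : R) : (1 - t) * X + t * Y = X + (Y - X) * t by ring.
have := @fractional_trapezoid_bound R f (derive1 f) a (a + h)
  (`|(derive1 f) a| `^ q) (`|(derive1 f) b| `^ q) p q alpha.
rewrite [a + h - a]addrC addKr => /(_ _ _ _ _ _ _ _ _ _)/[!ltrDl]/[!alpha_gt0] bound.
have {bound} : `|h `^ alpha * (f a + f (a + h)) - alpha * J| <=
    (h `^ (alpha * p + 1) / (alpha * p + 1)) `^ p^-1 *
    (h * ((`|(derive1 f) a| `^ q + `|(derive1 f) b| `^ q) / 2)) `^ q^-1.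
  apply: bound => //; try exact: powR_ge0.
  - move=> x xad; rewrite derive1E; apply/derivableP/df.
    by rewrite (xE x); exact: Ainv (t01 _ xad).
  - move=> x xad; have xad' : x \in `[a, a + h] by apply: subset_itv_oo_cc.
    have := f'inv a b Aa Ab _ (t01 x xad'); rewrite -/h -xE => /le_trans; apply.
    by rewrite aux.
move=> bound.
(* Gamma (alpha + 1) / Gamma alpha = alpha; a common factor 1 / (2 h^alpha) is then pulled out. *)
rewrite [X in `|X|](_ : _ =
    (2 * h `^ alpha)^-1 * (h `^ alpha * (f a + f (a + h)) - alpha * J)); last first.
  by have ha' := lt0r_neq0 ha; field; rewrite ha' G0.
have c0 : 0 < (2 * h `^ alpha)^-1 by rewrite invr_gt0 mulr_gt0.
rewrite normrM (gtr0_norm c0) (le_trans (ler_wpM2l (ltW c0) bound))//.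
rewrite powRM ?powR_ge0 ?invr_ge0 ?(ltW r1)//.
rewrite [(h * _) `^ _]powRM ?(ltW h0) ?divr_ge0 ?addr_ge0 ?powR_ge0//.
(* This h^alpha cancels the prefactor, and h^(1/p) h^(1/q) = h supplies the factor eta(b,a) of the
   bound. *)
have EH : (h `^ (alpha * p + 1)) `^ p^-1 = h `^ alpha * h `^ p^-1.
  rewrite -powRrM mulrDl mul1r mulfK ?gt_eqF// powRD//.
  by rewrite (gt_eqF h0) implybT.
have ER : (alpha * p + 1)^-1 `^ p^-1 = ((alpha * p + 1) `^ p^-1)^-1.
  by rewrite -(powR_inv1 (ltW r1)) powRAC powR_inv1 ?powR_ge0.
have EE : h `^ p^-1 * h `^ q^-1 = h.
  by rewrite -powRD ?pq ?powRr1 ?(ltW h0)// (gt_eqF h0) implybT.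
have aux2 (H Hp Hq Rp X : R) : H != 0 -> Rp != 0 ->
    (2 * H)^-1 * (H * Hp * Rp^-1 * (Hq * X)) = Hp * Hq / (2 * Rp) * X.
  by move=> H0 R0; field; rewrite H0 R0.
rewrite EH ER aux2; first by rewrite EE.
- by rewrite gt_eqF.
- by rewrite gt_eqF// powR_gt0.
Qed.
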